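(* Let $X$ be any infinite set. Then $\operatorname{rank}(\mathcal P_X:\mathcal S_X)=2$; that is, the minimum cardinality of a subset $U\subseteq\mathcal P_X$ such that $\mathcal P_X=\langle \mathcal S_X\cup U\rangle$ is equal to $2$.
   Context: Partition monoid: let $X'=\{x':x\in X\}$ be a disjoint copy of the set $X$. The elements of $\mathcal P_X$ are all set partitions $\alpha$ of $X\cup X'$ into nonempty blocks. Product: given $\alpha,\beta\in\mathcal P_X$, let $X''=\{x'':x\in X\}$ be a third disjoint copy of $X$; relabel each lower vertex $x'$ of (a graph whose connected components are the blocks of) $\alpha$ as $x''$, relabel each upper vertex $x$ of (a graph representing) $\beta$ as $x''$, and take the union of the two graphs on vertex set $X\cup X''\cup X'$. Then $\alpha\beta\in\mathcal P_X$ is the partition in which $u,v\in X\cup X'$ lie in the same block if and only if they are joined by a (finite) path in this graph. This makes $\mathcal P_X$ a monoid with identity $1=\{\{x,x'\}:x\in X\}$. $\mathcal S_X$ denotes the group of units of $\mathcal P_X$: the partitions all of whose blocks have the form $\{x,y'\}$ with $x,y\in X$ (isomorphic to the symmetric group on $X$). For a subset $T$ of a semigroup $S$, $\langle T\rangle$ is the subsemigroup generated by $T$, and the relative rank $\operatorname{rank}(S:T)$ is the minimum cardinality of a subset $U\subseteq S$ with $S=\langle T\cup U\rangle$. *)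

(* Defs.v *)
From HB Require Import structures.
From Stdlib Require Import Relation_Operators.
From mathcomp Require Import all_boot.
From mathcomp Require Import boolp classical_sets functions cardinality.

Set Implicit Arguments.
Unset Strict Implicit.
Unset Printing Implicit Defensive.

Local Open Scope classical_set_scope.
Local Open Scope card_scope.

(** ** Generation and relative rank *)

Definition subsemigroup (S : semigroupType) (A : set S) : Prop :=
  forall x y : S, A x -> A y -> A (x * y)%g.

Definition sgenerated (S : semigroupType) (T : set S) : set S :=
  smallest (@subsemigroup S) T.

(* rank(S : T) is the cardinality of [C].  Cardinals are not a type here, so a
   cardinal is given by a representative set [C], compared with [#=], [#<=];
   [U] is not assumed to be finite. *)
Definition has_relative_rank (S : semigroupType) (T : set S)
    (K : Type) (C : set K) : Prop :=
  (exists2 U : set S, sgenerated (T `|` U) = [set: S] & U #= C) /\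
  (forall U : set S, sgenerated (T `|` U) = [set: S] -> C #<= U).

Definition units (M : monoidType) : set M :=
  [set x | exists y : M, (x * y = 1 /\ y * x = 1)%g].
Arguments units : clear implicits.

(** ** The partition monoid *)

(* In [X + X], [inl x] is the upper vertex x and [inr x] the lower vertex x'. *)
Record pmonoid (X : Type) := PMonoid {
  blocks : set (set (X + X));
  blocksP : classical_sets.partition blocks id [set: X + X]
}.

Definition same_block (X : Type) (a : pmonoid X) (u v : X + X) : Prop :=
  exists2 B, blocks a B & B u /\ B v.

(* The vertices x, x'' and x' of the product graph. *)
Inductive vertex (X : Type) := Upper of X | Middle of X | Lower of X.

Definition left_vertex (X : Type) (u : X + X) : vertex X :=
  match u with inl x => Upper x | inr x => Middle x end.

Definition right_vertex (X : Type) (u : X + X) : vertex X :=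
  match u with inl x => Middle x | inr x => Lower x end.

Definition outer_vertex (X : Type) (u : X + X) : vertex X :=
  match u with inl x => Upper x | inr x => Lower x end.

(* Each block is represented by the complete graph (with loops) on it. *)
Inductive product_edge (X : Type) (a b : pmonoid X) :
    vertex X -> vertex X -> Prop :=
| LeftEdge u v of same_block a u v :
    product_edge a b (left_vertex u) (left_vertex v)
| RightEdge u v of same_block b u v :
    product_edge a b (right_vertex u) (right_vertex v).

(* Edges are symmetric, so directed paths are enough. *)
Definition connected (X : Type) (a b : pmonoid X) :
    vertex X -> vertex X -> Prop :=
  clos_refl_trans (vertex X) (product_edge a b).

Definition component (X : Type) (a b : pmonoid X) (u : X + X) : set (X + X) :=
  [set v | connected a b (outer_vertex u) (outer_vertex v)].

Section PartitionMonoid.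
Variable X : Type.
Implicit Types (a b c : pmonoid X) (u v w : X + X) (p q r : vertex X).

Lemma same_block_refl a u : same_block a u u.
Proof.
have [cov _ _] := blocksP a.
have : [set: X + X] u by [].
by rewrite -cov => -[B aB Bu]; exists B.
Qed.

Lemma same_block_sym a u v : same_block a u v -> same_block a v u.
Proof. by move=> [B aB [Bu Bv]]; exists B. Qed.

Lemma block_unique a (B C : set (X + X)) u :
  blocks a B -> blocks a C -> B u -> C u -> B = C.
Proof.
have [_ triv _] := blocksP a.
by move=> aB aC Bu Cu; apply: (triv B C) => //; exists u.
Qed.

Lemma same_block_trans a u v w :
  same_block a u v -> same_block a v w -> same_block a u w.
Proof.
move=> [B aB [Bu Bv]] [C aC [Cv Cw]]; exists B => //.
by rewrite -(block_unique aB aC Bv Cv) in Cw.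
Qed.

Lemma blockE a B u : blocks a B -> B u -> B = [set v | same_block a u v].
Proof.
move=> aB Bu; apply/seteqP; split=> v /= => [Bv|[C aC [Cu Cv]]].
  by exists B.
by rewrite (block_unique aB aC Bu Cu).
Qed.

Lemma blocksE a : blocks a = range (fun u => [set v | same_block a u v]).
Proof.
have [cov _ nonempty] := blocksP a.
apply/seteqP; split=> B => [aB|[u _ <-]].
  have [u Bu] := nonempty B aB.
  by exists u => //; rewrite (blockE aB Bu).
have [C aC [Cu _]] := same_block_refl a u.
by rewrite -(blockE aC Cu).
Qed.

Lemma pmonoid_ext a b :
  (forall u v, same_block a u v <-> same_block b u v) -> a = b.
Proof.
move=> ab; have eq_blocks : blocks a = blocks b.
  rewrite !blocksE; suff -> : same_block a = same_block b by [].
  apply/funext => u.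
  by apply/funext => v; exact: propext (ab u v).
case: a b eq_blocks {ab} => [A PA] [B PB] /= AB.
by case: B / AB PB => PB; congr PMonoid; exact: Prop_irrelevance.
Qed.

Lemma equiv_partition (R : X + X -> X + X -> Prop) :
  (forall u, R u u) -> (forall u v, R u v -> R v u) ->
  (forall u v w, R u v -> R v w -> R u w) ->
  classical_sets.partition (range (fun u => [set v | R u v])) id
    [set: X + X].
Proof.
move=> Rxx Rsym Rtrans; split.
- by apply/seteqP; split=> // u _; exists [set v | R u v] => //; exists u.
- move=> _ _ [u _ <-] [v _ <-] [w [/= uw vw]].
  have uv : R u v by apply: (Rtrans _ w) => //; exact: Rsym.
  apply/seteqP; split=> z /=; last exact: Rtrans.
  by apply: Rtrans; exact: Rsym.
- by move=> _ [u _ <-]; exists u; exact: Rxx.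
Qed.

Lemma connected_refl a b p : connected a b p p.
Proof. exact: rt_refl. Qed.

Lemma connected_trans a b p q r :
  connected a b p q -> connected a b q r -> connected a b p r.
Proof. exact: rt_trans. Qed.

Lemma connected_left a b u v :
  same_block a u v -> connected a b (left_vertex u) (left_vertex v).
Proof. by move=> auv; apply: rt_step; constructor. Qed.

Lemma connected_right a b u v :
  same_block b u v -> connected a b (right_vertex u) (right_vertex v).
Proof. by move=> buv; apply: rt_step; constructor. Qed.

Lemma connected_ind_l a b (P : vertex X -> Prop) p q :
  connected a b p q ->
  (forall u v, same_block a u v -> P (left_vertex u) -> P (left_vertex v)) ->
  (forall u v, same_block b u v -> P (right_vertex u) -> P (right_vertex v)) ->
  P p -> P q.
Proof.
move=> pq Pl Pr; elim: pq => {p q} [p q [] u v|//|p q r _ pq _ qr /pq//].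
  exact: Pl.
exact: Pr.
Qed.

Lemma connected_sym a b p q : connected a b p q -> connected a b q p.
Proof.
move=> pq; apply: (connected_ind_l (P := fun r => connected a b r p) pq).
- move=> u v /same_block_sym uv.
  exact/connected_trans/connected_left.
- move=> u v /same_block_sym uv.
  exact/connected_trans/connected_right.
- exact: connected_refl.
Qed.

Lemma component_partition a b :
  classical_sets.partition (range (component a b)) id [set: X + X].
Proof.
apply: equiv_partition => [u|u v|u v w].
- exact: connected_refl.
- exact: connected_sym.
- exact: connected_trans.
Qed.

Definition pmul a b : pmonoid X := PMonoid (component_partition a b).

Lemma same_block_pmul a b u v :
  same_block (pmul a b) u v <-> connected a b (outer_vertex u) (outer_vertex v).
Proof.
split=> [[_ [w _ <-] [/= wu wv]]|uv].
  exact: connected_trans (connected_sym wu) wv.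
exists (component a b u); first by exists u.
by split=> //; exact: connected_refl.
Qed.

Lemma pone_partition :
  classical_sets.partition (range (fun x : X => [set inl x; inr x])) id
    [set: X + X].
Proof.
split.
- apply/seteqP; split=> // -[] x _;
    (exists [set inl x; inr x]; first by exists x).
  + by left.
  + by right.
- move=> _ _ [x _ <-] [y _ <-] [z [/= xz yz]].
  suff -> : x = y by [].
  by case: z xz yz => z [] // [<-] [] // [<-].
- by move=> _ [x _ <-]; exists (inl x); left.
Qed.

Definition pone : pmonoid X := PMonoid pone_partition.

Definition untag u : X := match u with inl x => x | inr x => x end.

Lemma same_block_pone u v : same_block pone u v <-> untag u = untag v.
Proof.
split=> [[_ [x _ <-] [/= [] -> [] ->]]//|uv].
exists [set inl (untag u); inr (untag u)]; first by exists (untag u).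
by split; [case: u {uv} => x /=|rewrite uv; case: v {uv} => x /=]; by [left|right].
Qed.

(* The anti-involution exchanging upper and lower vertices. *)
Definition swap u : X + X := match u with inl x => inr x | inr x => inl x end.

Lemma flip_partition a :
  classical_sets.partition
    (range (fun u => [set v | same_block a (swap u) (swap v)])) id [set: X + X].
Proof.
apply: equiv_partition => [u|u v|u v w].
- exact: same_block_refl.
- exact: same_block_sym.
- exact: same_block_trans.
Qed.

Definition pflip a : pmonoid X := PMonoid (flip_partition a).

Lemma same_block_pflip a u v :
  same_block (pflip a) u v <-> same_block a (swap u) (swap v).
Proof.
split=> [[_ [w _ <-] [/= wu wv]]|uv].
  exact: same_block_trans (same_block_sym wu) wv.
exists [set z | same_block a (swap u) (swap z)]; first by exists u.
by split=> //; exact: same_block_refl.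
Qed.

Lemma pflipK a : pflip (pflip a) = a.
Proof. by apply: pmonoid_ext => -[]x []y; rewrite !same_block_pflip. Qed.

Lemma pflip1 : pflip pone = pone.
Proof.
by apply: pmonoid_ext => -[]x []y; rewrite same_block_pflip !same_block_pone.
Qed.

Definition vswap p : vertex X :=
  match p with Upper x => Lower x | Middle x => Middle x | Lower x => Upper x end.

Lemma connected_flip a b p q :
  connected a b p q -> connected (pflip b) (pflip a) (vswap p) (vswap q).
Proof.
move=> pq.
apply: (connected_ind_l
  (P := fun r => connected (pflip b) (pflip a) (vswap p) (vswap r)) pq).
- move=> u v auv /connected_trans; apply.
  have E w : vswap (left_vertex w) = right_vertex (swap w) by case: w.
  rewrite !E.
  apply: connected_right; apply/same_block_pflip.
  by case: u v auv => ? [].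
- move=> u v buv /connected_trans; apply.
  have E w : vswap (right_vertex w) = left_vertex (swap w) by case: w.
  rewrite !E.
  apply: connected_left; apply/same_block_pflip.
  by case: u v buv => ? [].
- exact: connected_refl.
Qed.

Lemma pflipM a b : pflip (pmul a b) = pmul (pflip b) (pflip a).
Proof.
apply: pmonoid_ext => u v; rewrite same_block_pflip !same_block_pmul.
split=> /connected_flip; rewrite ?pflipK; by case: u v => ? [].
Qed.

Lemma pmul_assoc_sub a b c u v :
  same_block (pmul (pmul a b) c) u v -> same_block (pmul a (pmul b c)) u v.
Proof.
rewrite !same_block_pmul => uv.
pose conn := connected a (pmul b c).
(* [through z]: the vertex [z] of the middle row between [b] and [c] is joined
   to [u] *)
pose through z := exists2 d, connected b c (Middle z) (outer_vertex d)
                             & conn (outer_vertex u) (right_vertex d).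
pose P r := match r with Middle z => through z | _ => conn (outer_vertex u) r end.
suff : P (outer_vertex v) by case: (v).
apply: (connected_ind_l (P := P) uv).
- move=> w w' /same_block_pmul ww'.
  pose Q r := match r with Lower z => through z | _ => conn (outer_vertex u) r end.
  have Pl z : P (left_vertex z) = Q (outer_vertex z) by case: z.
  rewrite !Pl.
  apply: (connected_ind_l (P := Q) ww') => s t st.
  + have Ql z : Q (left_vertex z) = conn (outer_vertex u) (left_vertex z).
      by case: z.
    by rewrite !Ql => /connected_trans; apply; exact: connected_left.
  + have bc := connected_left c st.
    have Qr z : Q (right_vertex z) <->
        exists2 d, connected b c (left_vertex z) (outer_vertex d)
                 & conn (outer_vertex u) (right_vertex d).
      case: z => z //=; split=> [uz|[d zd ud]].
        by exists (inl z) => //; exact: connected_refl.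
      apply: connected_trans ud _.
      apply: (@connected_right a (pmul b c) d (inl z)).
      by apply/same_block_pmul; exact: connected_sym.
    move=> /Qr[d sd ud]; apply/Qr; exists d => //.
    exact: connected_trans (connected_sym bc) sd.
- move=> s t st.
  have bc := connected_right b st.
  have Pr z : P (right_vertex z) <->
      exists2 d, connected b c (right_vertex z) (outer_vertex d)
               & conn (outer_vertex u) (right_vertex d).
    case: z => z //=; split=> [uz|[d zd ud]].
      by exists (inr z) => //; exact: connected_refl.
    apply: connected_trans ud _.
    apply: (@connected_right a (pmul b c) d (inr z)).
    by apply/same_block_pmul; exact: connected_sym.
  move=> /Pr[d sd ud]; apply/Pr; exists d => //.
  exact: connected_trans (connected_sym bc) sd.
- have Pout z : P (outer_vertex z) = conn (outer_vertex u) (outer_vertex z) by case: z.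
  by rewrite Pout; exact: connected_refl.
Qed.

Lemma pmulA : associative pmul.
Proof.
move=> a b c; apply: pmonoid_ext => u v; split; last exact: pmul_assoc_sub.
have swapK w : swap (swap w) = w by case: w.
move=> uv.
suff : same_block (pflip (pmul (pmul a b) c)) (swap u) (swap v).
  by rewrite same_block_pflip !swapK.
rewrite !pflipM; apply: pmul_assoc_sub; rewrite -!pflipM.
by apply/same_block_pflip; rewrite !swapK.
Qed.

Lemma pmul1 : right_id pone pmul.
Proof.
move=> a; apply: pmonoid_ext => u v; rewrite same_block_pmul.
pose f p := match p with Upper x => inl x | Middle x | Lower x => inr x end.
have outer_left w : connected a pone (outer_vertex w) (left_vertex w).
  case: w => x; first exact: connected_refl.
  apply: (@connected_right a pone (inr x) (inl x)).
  exact/same_block_pone.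
split=> [uv|uv].
  suff : same_block a u (f (outer_vertex v)) by case: (v).
  apply: (connected_ind_l (P := fun r => same_block a u (f r)) uv).
  - move=> w w' ww' uw; apply: (same_block_trans (v := w)); first by case: (w) uw.
    by case: (w') ww'.
  - by move=> [] w [] w' /same_block_pone /= ->.
  - by case: (u) => x; exact: same_block_refl.
apply: connected_trans (outer_left u) _.
apply: connected_trans (connected_sym (outer_left v)).
exact: connected_left.
Qed.

Lemma pmul_1 : left_id pone pmul.
Proof. by move=> a; rewrite -[LHS]pflipK pflipM pflip1 pmul1 pflipK. Qed.

End PartitionMonoid.

HB.instance Definition _ (X : Type) := gen_eqMixin (pmonoid X).
HB.instance Definition _ (X : Type) := gen_choiceMixin (pmonoid X).
HB.instance Definition _ (X : Type) :=
  isMonoid.Build (pmonoid X) (@pmulA X) (@pmul_1 X) (@pmul1 X).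

Section Units.
Variable X : Type.
Implicit Types (a b : pmonoid X).

Lemma unit_upper a b x : pmul a b = pone X -> pmul b a = pone X ->
  exists2 y, same_block a (inl x) (inr y) &
    forall u, same_block a (inl x) u -> u = inl x \/ u = inr y.
Proof.
move=> ab ba.
have upper_inj z t : same_block a (inl z) (inl t) -> z = t.
  move=> /(connected_left b) zt.
  have /same_block_pone // : same_block (pone X) (inl z) (inl t).
  by rewrite -ab; apply/same_block_pmul.
have lower_inj z t : same_block a (inr z) (inr t) -> z = t.
  move=> /(connected_right b) zt.
  have /same_block_pone // : same_block (pone X) (inr z) (inr t).
  by rewrite -ba; apply/same_block_pmul.
have [y xy] : exists y, same_block a (inl x) (inr y).
  apply: contrapT => noy.
  have : same_block (pmul a b) (inl x) (inr x) by rewrite ab; apply/same_block_pone.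
  move=> /same_block_pmul xx.
  apply: (connected_ind_l xx
    (P := fun p => if p is Upper z then same_block a (inl x) (inl z)
                   else False)) => [[]z []t zt //= xz|[]z []t //|]; last exact: same_block_refl.
  - exact: same_block_trans xz zt.
  - by apply: noy; exists t; exact: same_block_trans xz zt.
exists y => // -[z /upper_inj -> //|z xz]; [by left|right].
by rewrite (@lower_inj z y) //; apply: same_block_trans xy; exact: same_block_sym.
Qed.

Lemma units_blocksE : units (pmonoid X) =
  [set a | forall B, blocks a B -> exists x y : X, B = [set inl x; inr y]].
Proof.
apply/seteqP; split=> a /=.
  move=> [b [ab ba]] B aB.
  suff [x Bx] : exists x, B (inl x).
    have [y xy uniq] := unit_upper x ab ba; exists x, y.
    rewrite (blockE aB Bx); apply/seteqP; split=> [u /uniq //|u [] -> //].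
    exact: same_block_refl.
  have [_ _ /(_ B aB) [[x|y]]] := blocksP a; first by exists x.
  have ba' : pmul (pflip a) (pflip b) = pone X by rewrite -pflipM [pmul b a]ba pflip1.
  have ab' : pmul (pflip b) (pflip a) = pone X by rewrite -pflipM [pmul a b]ab pflip1.
  have := unit_upper y ba' ab' => -[x /same_block_pflip yx _] By; exists x.
  by rewrite (blockE aB By).
suff inv b : (forall B, blocks b B -> exists x y : X, B = [set inl x; inr y]) ->
    pmul b (pflip b) = pone X.
  move=> aB; exists (pflip a); split; first exact: inv.
  rewrite -[X in (_ * X)%g]pflipK; apply: inv => B; rewrite blocksE => -[u _ <-].
  have [C aC [Cu _]] := same_block_refl a (swap u).
  have [x [y Cxy]] := aB C aC; exists y, x; apply/seteqP.
  have e v : same_block (pflip a) u v <-> C (swap v).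
    by rewrite same_block_pflip (blockE aC Cu).
  split=> v /=; rewrite e Cxy.
  - by case: v => z [] //= [->]; [left|right].
  - by case=> ->; [right|left].
move=> bB.
have upper x : exists y, same_block b (inl x) (inr y).
  have [B bBl [Bx _]] := same_block_refl b (inl x).
  have [z [y Bzy]] := bB B bBl; exists y; exists B => //.
  by split=> //; rewrite Bzy; right.
have upper_inj y z : same_block b (inl y) (inl z) -> y = z.
  by move=> [B /bB[x [t ->]]] /= [[]// [->] []// [->]].
have UL x : connected b (pflip b) (Upper x) (Lower x).
  have [y xy] := upper x.
  apply: connected_trans (connected_left (pflip b) xy) _.
  apply: (@connected_right _ b (pflip b) (inl y) (inr x)).
  by apply/same_block_pflip; exact: same_block_sym.
apply: pmonoid_ext => u v; rewrite same_block_pmul same_block_pone.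
have out w : connected b (pflip b) (outer_vertex w) (Upper (untag w)).
  by case: w => x /=; [exact: connected_refl|exact: connected_sym].
split=> uv; last first.
  by apply: connected_trans (out u) _; rewrite uv; exact: connected_sym.
pose f (p : vertex X) := match p with Upper x | Lower x => inl x | Middle y => inr y end.
suff : same_block b (inl (untag u)) (f (outer_vertex v)).
  by case: (v) => x /= /upper_inj.
apply: (connected_ind_l
  (P := fun p => same_block b (inl (untag u)) (f p)) uv).
- move=> s t st us; apply: same_block_trans (_ : same_block b _ s) _.
    by case: (s) us.
  by case: (t) st.
- move=> s t /same_block_pflip st us.
  apply: same_block_trans (_ : same_block b _ (swap s)) _; first by case: (s) us.
  by case: (t) st.
- by case: (u) => x; exact: same_block_refl.
Qed.

End Units.

(* Main.v *)
(* Put V = X + X, so that a partition in P_X is an equivalence relation on V,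
   and let f : X -> V have all its fibres of cardinality |V| = |X|.  Let alpha
   be the partition joining x to all y' with f y = inl x and joining the y'
   with equal f y, and beta the one joining x' to all y with f y = inr x and
   joining the y with equal f y.  For a unit g given by a permutation s of X,
   the product alpha g beta is described by the bipartite multigraph on two
   copies of V having an edge from f y to f (s y) for every y : X.  Since all
   degrees are |V|, some involution s makes these edges link u to v exactly
   when u and v lie in the same block of a prescribed gamma, and then
   gamma = alpha g beta.

   Two generators are needed since alpha is right invertible but not left
   invertible: in a product equal to a right (left) invertible non-unit, the
   first (last) factor that is not a unit is right (left) invertible, so U
   contains a right invertible non-unit and a left invertible one, and they
   differ. *)
Require Import Defs.
From mathcomp Require Import all_boot.
From mathcomp Require Import boolp classical_sets functions cardinality.

Local Open Scope classical_set_scope.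
Local Open Scope card_scope.

(** * Cardinal arithmetic of infinite sets *)

(** Choice picks one image for each point, so a multivalued relation may be supplied; [card_le_setU]
    relies on this. *)
Lemma rel_card_le {T U : Type} {A : set T} {B : set U} (R : T -> U -> Prop) :
  (forall x, A x -> exists2 y, B y & R x y) ->
  (forall x x' y, A x -> A x' -> R x y -> R x' y -> x = x') ->
  A #<= B.
Proof.
move=> tot inj.
have tot' (x : A) : exists y : B, R (val x) (val y).
  have [y By xy] := tot _ (set_valP x).
  by exists (SigSub (mem_set By)).
have [f fR] := choice tot'.
have fI : {in [set: A] &, injective f}.
  move=> x y _ _ fxy; apply: val_inj.
  apply: inj (fR x) _; rewrite ?fxy //; exact: set_valP.
by apply/card_leP/injfunPex; exists f.
Qed.

Lemma exfun_card_leP {T : Type} {U : pointedType} {A : set T} {B : set U} :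
  A #<= B <-> exists2 f : T -> U, set_fun A B f & {in A &, injective f}.
Proof.
by rewrite -injfunPex; split=> [/pcard_leP|AB]; last exact/pcard_leP.
Qed.

(** Zorn's lemma gives a maximal graph of a partial injection from [A] to [B]. If it missed some [a]
    in [A] and some [b] in [B], the pair [(a, b)] could be added. *)
Lemma card_le_total {T U : Type} (A : set T) (B : set U) :
  A #<= B \/ B #<= A.
Proof.
pose P (G : set (T * U)) := [/\ G `<=` A `*` B,
  forall x x' y, G (x, y) -> G (x', y) -> x = x' &
  forall x y y', G (x, y) -> G (x, y') -> y = y'].
have [F FP Fchain|G [[GAB Ginj Gfun] Gmax]] := @Zorn_bigcup _ P.
  have pair p q : (\bigcup_(G in F) G) p -> (\bigcup_(G in F) G) q ->
      exists2 G, P G & G p /\ G q.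
    move=> [G FG Gp] [H FH Hq].
    have [GH|HG] := Fchain _ _ FG FH.
      by exists H; [exact: FP|split; auto].
    by exists G; [exact: FP|split; auto].
  split=> [p [G /FP[GAB _ _] /GAB]//|x x' y|x y y'] => Gx Gy.
  - by have [G [_ + _] []] := pair _ _ Gx Gy; apply.
  - by have [G [_ _ +] []] := pair _ _ Gx Gy; apply.
have [totA|] := pselect (forall x, A x -> exists2 y, B y & G (x, y)).
  by left; apply: rel_card_le totA _ => x x' y _ _; exact: Ginj.
have [totB _|] := pselect (forall y, B y -> exists2 x, A x & G (x, y)).
  by right; apply: rel_card_le totB _ => y y' x _ _; exact: Gfun.
move=> /existsNP[b /not_implyP[Bb Gb]] /existsNP[a /not_implyP[Aa Ga]].
exfalso; apply: (Gmax (G `|` [set (a, b)])).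
  split=> [p|]; first by left.
  by move=> /(_ (a, b))/(_ (or_intror erefl)) Gab; apply: Gb; exists a.
have Gxb x : ~ G (x, b) by move=> /[dup]/GAB[/= Ax _] Gxb; apply: Gb; exists x.
have Gay y : ~ G (a, y) by move=> /[dup]/GAB[/= _ By] Gay; apply: Ga; exists y.
split=> [p [/GAB//|->//]|x x' y|x y y'].
- move=> [Gx|[-> yb]] [Gx'|[xa' yb']] //; [exact: Ginj Gx Gx'| |].
  + by rewrite yb' in Gx; case: (Gxb x).
  + by rewrite yb in Gx'; case: (Gxb x').
- move=> [Gx|[xa ->]] [Gx'|[xa' yb']] //; [exact: Gfun Gx Gx'| |].
  + by rewrite xa' in Gx; case: (Gay y).
  + by rewrite xa in Gx'; case: (Gay y').
Qed.

Lemma card_le_setX {T T' U U' : Type} {A : set T} {A' : set T'} {B : set U}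
    {B' : set U'} : A #<= B -> A' #<= B' -> A `*` A' #<= B `*` B'.
Proof.
elim/Ppointed: U => U in B *.
  by rewrite (empty_eq0 B) => /card_le0P-> _; rewrite set0X.
elim/Ppointed: U' => U' in B' *.
  by rewrite (empty_eq0 B') => _ /card_le0P->; rewrite setX0.
move=> /exfun_card_leP[f fAB finj] /exfun_card_leP[g gAB ginj].
apply/exfun_card_leP; exists (fun p => (f p.1, g p.2)).
  by move=> p [/fAB ? /gAB ?].
move=> [x x'] [y y'] /set_mem[/= Ax Ax'] /set_mem[/= Ay Ay'] [fxy gxy].
by congr pair; [apply: finj|apply: ginj]; rewrite ?inE.
Qed.

(** The tags [a] and [b] keep apart the points of [A] and the images in [A] of the points of [B]. *)
Lemma card_le_setU {T : pointedType} {A B : set T} {a b : T} :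
  A a -> A b -> a <> b -> B #<= A -> A `|` B #<= A `*` A.
Proof.
move=> Aa Ab ab /exfun_card_leP[f fBA finj].
apply: (rel_card_le
  (fun x p => A x /\ p = (x, a) \/ B x /\ p = (f x, b))).
  by move=> x [Ax|Bx]; [exists (x, a); [|left]|
    exists (f x, b); [split=> //; exact: fBA|right]].
move=> x y p _ _ [[Ax ->]|[Bx ->]] [[Ay]|[By]] [] // fxy.
- by move=> e; case: (ab (esym e)).
- by apply: finj; rewrite ?inE.
Qed.

(* Zorn's lemma is applied to injections of a square A x A into A, encoded as
   relations; A is recovered from the diagonal. *)
Lemma infinite_card_setXTT {T : Type} : infinite_set [set: T] ->
  [set: T * T] #= [set: T].
Proof.
elim/Ppointed: T => T infT; first by case: infT; rewrite empty_eq0.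
apply/Cantor_Bernstein; last first.
  by apply: (rel_card_le (fun x p => p = (x, x))) => [x _|x y p _ _ -> []//];
    exists (x, x).
pose side (G : set (T * T * T)) : set T := [set x | exists z, G (x, x, z)].
pose P (G : set (T * T * T)) := [/\
  forall x y z, G (x, y, z) -> [/\ side G x, side G y & side G z],
  forall x y, side G x -> side G y -> exists z, G (x, y, z) &
  forall p q z, G (p, z) -> G (q, z) -> p = q].
have [F FP Fchain|G [[Gside Gtot Ginj] Gmax]] := @Zorn_bigcup _ P.
  have pair p q : (\bigcup_(G in F) G) p -> (\bigcup_(G in F) G) q ->
      exists2 G, F G & G p /\ G q.
    move=> [G FG Gp] [H FH Hq].
    have [GH|HG] := Fchain _ _ FG FH; first by exists H => //; split; auto.
    by exists G => //; split; auto.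
  split=> [x y z [G FG Gxyz]|x y [z Gx] [t Gy]|p q z Gp Gq].
  - have [+ _ _] := FP _ FG => /(_ _ _ _ Gxyz)[[x' ?] [y' ?] [z' ?]].
    by split; [exists x'|exists y'|exists z']; exists G.
  - have [G FG [Gxz Gyt]] := pair _ _ Gx Gy.
    have [_ + _] := FP _ FG => /(_ x y)[|//|w Gw]; [by exists z|by exists t|].
    by exists w, G.
  - have [G FG [Gpz Gqz]] := pair _ _ Gp Gq.
    by have [_ _] := FP _ FG; apply; [exact: Gpz|].
pose A := side G.
have AA : A `*` A #<= A.
  apply: (rel_card_le (fun p z => G (p, z))) => [[x y] [/= Ax Ay]|p q z _ _].
    by have [z Gz] := Gtot x y Ax Ay; exists z => //; have [] := Gside _ _ _ Gz.
  exact: Ginj.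
(* Otherwise G would extend to A u B, contradicting its maximality. *)
have extend (B : set T) : B !=set0 -> B `&` A = set0 ->
    ~ ((A `|` B) `*` (A `|` B) #<= B).
  move=> [b Bb] /disjoints_subset BA /exfun_card_leP[f fB finj].
  (* [H] sends into [B] the pairs of the enlarged square outside the square of [A]; its values avoid
     [A], hence those of [G]. *)
  pose H : set (T * T * T) := [set q | [/\ (A `|` B) q.1.1, (A `|` B) q.1.2,
    ~ (A q.1.1 /\ A q.1.2) & q.2 = f q.1]].
  have sideGH : side (G `|` H) = A `|` B.
    apply/seteqP; split=> x.
      by move=> [z [Gz|[/= //]]]; left; exists z.
    move=> [[z Gz]|Bx]; first by exists z; left.
    by exists (f (x, x)); right; split=> /=; [right|right|move=> [/(BA x Bx)]|].
  apply: (Gmax (G `|` H)).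
    split=> [p|]; first by left.
    move=> /(_ (b, b, f (b, b))) GHb; apply: (BA b Bb).
    exists (f (b, b)); apply: GHb.
    by right; split=> /=; [right|right|move=> [/(BA b Bb)]|].
  have GH p q z : G (p, z) -> H (q, z) -> p = q.
    move: p => [p1 p2] /Gside[_ _ Az] [/= q1 q2 _ zf].
    by exfalso; apply: (BA z) Az; rewrite zf; exact: fB.
  split; rewrite ?sideGH.
  - move=> x y z [/Gside[? ? ?]|[/= ? ? _ ->]]; split=> //; try by left.
    by right; apply: fB.
  - move=> x y ABx ABy.
    have [[Ax Ay]|nA] := pselect (A x /\ A y).
      by have [z Gz] := Gtot x y Ax Ay; exists z; left.
    by exists (f (x, y)); right.
  - move=> p q z [Gp|Hp] [Gq|Hq].
    + exact: Ginj Gp Gq.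
    + exact: GH Gp Hq.
    + exact/esym/(GH q p z).
    + case: Hp Hq => [/= ? ? _ ->] [/= ? ? _] /finj.
      by apply; rewrite inE; split => /=.
(* A finite [A] is excluded by taking for [B] a copy of the naturals in its complement, as the union
   is then countable. *)
have [finA|infA] := pselect (finite_set A).
  have /infiniteP : infinite_set (~` A) by rewrite -setTD; exact: infinite_setD.
  move=> /exfun_card_leP[f fA finj].
  case: (extend (range f)).
  - by exists (f 0); exists 0.
  - by apply/disjoints_subset => _ [n _ <-]; exact: fA.
  - apply: (card_le_trans (B := [set: nat])).
      have cAB : countable (A `|` range f).
        rewrite -bigcup2E; apply: bigcup_countable => // -[|[|n]] _ //=.
          exact: finite_set_countable.
        exact: sub_countable (card_image_le _ _) (countableP _).
      exact: countableX.
    by have /card_eqPle[] := inj_card_eq finj.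
have [a Aa] := infinite_setN0 infA.
have [b [Ab ba]] := infinite_setN0 (infinite_setD infA (finite_set1 a)).
have AU B : B #<= A -> (A `|` B) `*` (A `|` B) #<= A.
  move=> BA; have ABA := card_le_trans (card_le_setU Ab Aa ba BA) AA.
  exact: card_le_trans (card_le_setX ABA ABA) AA.
(* If the complement embeds in [A], so does the square of the whole type. Otherwise the complement
   contains a copy of [A], which [extend] forbids. *)
have [AC|CA] := card_le_total A (~` A); last first.
  have := AU _ CA; rewrite setUCr setXTT => /card_le_trans; apply.
  exact: card_leT.
have /exfun_card_leP[f fA finj] := AC.
have /card_eqPle[fAA AfA] := inj_card_eq finj.
case: (extend (f @` A)).
- by exists (f a); exists a.
- by apply/disjoints_subset => _ [x Ax <-]; exact: fA.
- exact: card_le_trans (AU _ fAA) AfA.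
Qed.

Lemma infinite_set_distinct {T : Type} : infinite_set [set: T] ->
  exists a b : T, a <> b.
Proof.
move=> infT; have [b _] := infinite_setN0 infT.
have [a [_ ab]] := infinite_setN0 (infinite_setD infT (finite_set1 b)).
by exists a, b.
Qed.

Lemma infinite_card_sum {T : Type} : infinite_set [set: T] ->
  [set: T + T] #= [set: T].
Proof.
move=> infT; have [a [b ab]] := infinite_set_distinct infT.
have /card_eqPle[TT _] := infinite_card_setXTT infT.
apply/Cantor_Bernstein; last first.
  by apply: (rel_card_le (fun x u => u = inl x)) => [x _|x y u _ _ -> []//];
    exists (inl x).
apply: card_le_trans TT.
apply: (rel_card_le (fun u p =>
  p = match u with inl x => (x, a) | inr x => (x, b) end)).
  by move=> u _; eexists.
by move=> [x|x] [y|y] p _ _ -> [] // -> // e; case: ab.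
Qed.

(** * Involutions whose edges realise a prescribed relation *)

Lemma infinite_set_card_eq {T U : Type} {A : set T} {B : set U} :
  A #= B -> infinite_set A -> infinite_set B.
Proof. by move=> /card_eqPle[AB _]; exact/contra_not/card_le_finite. Qed.

(* Fix bijections phi u from V onto {v | E u v} x V. The pairs (u, t) of
   V x V are thus the triples (u, v, w) with E u v, on which exchanging u and v
   is an involution. *)
Lemma edge_switching_involution {V : Type} {E : V -> V -> Prop} :
  infinite_set [set: V] -> (forall u, E u u) -> (forall u v, E u v -> E v u) ->
  exists s : V * V -> V * V, [/\ involutive s, forall p, E p.1 (s p).1 &
    forall u v, E u v -> exists p, p.1 = u /\ (s p).1 = v].
Proof.
elim/Ppointed: V => V in E *; first by rewrite empty_eq0 => -[].
move=> infV Exx Esym.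
have phi_ex u : exists phi : V -> V * V,
    set_bij [set: V] ([set v | E u v] `*` [set: V]) phi.
  apply/card_set_bijP/Cantor_Bernstein.
    (* Reflexivity of [E] puts the slice over [u] in the target, which therefore has at least the
       size of [V]. *)
    apply: (rel_card_le (fun t p => p = (u, t))).
      by move=> t _; exists (u, t) => //; split=> //=.
    by move=> t t' p _ _ -> [].
  apply: (card_le_trans (card_leT _)).
  by have /card_eqPle[] := infinite_card_setXTT infV.
have [phi /all_and3[phiE phi_inj phi_surj]] := choice phi_ex.
have psi_ex u : exists psi : V * V -> V, forall p, E u p.1 -> phi u (psi p) = p.
  suff psi_p p : exists t, E u p.1 -> phi u t = p.
    by have [psi psiK] := choice psi_p; exists psi.
  (* Outside the range of [phi u] the value is arbitrary; [u] is a default. *)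
  have [Eup|] := pselect (E u p.1); last by exists u.
  by have [t _ <-] := phi_surj u p (conj Eup I); exists t.
have [psi psiK] := choice psi_ex.
have phiE' u t : E u (phi u t).1 by have [] := phiE u t I.
have phiK u t : psi u (phi u t) = t.
  by apply: (phi_inj u); rewrite ?inE // psiK.
pose s (p : V * V) := let q := phi p.1 p.2 in (q.1, psi q.1 (p.1, q.2)).
exists s; split=> [[u t]|[u t]|u v Euv] //=.
- rewrite /s /= psiK /=; last exact: Esym.
  by rewrite -surjective_pairing phiK.
(* The triple [(u, v, w)] is an edge from [u] to [v] for every [w]; here [w] is [v]. *)
- by exists (u, psi u (v, v)); rewrite /s /= psiK.
Qed.

(** A bijection [h] from [X] to the square of [X + X] transports the edge-switching involution to
    [X]; [f] is the first coordinate of [h]. The repeated label will show that [upper_factor f] is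
    not left invertible. *)
Lemma involution_labelling {X : Type} : infinite_set [set: X] ->
  exists2 f : X -> X + X, exists y y', y <> y' /\ f y = f y' &
  forall E : X + X -> X + X -> Prop,
    (forall u, E u u) -> (forall u v, E u v -> E v u) ->
    exists s : X -> X, [/\ involutive s, forall y, E (f y) (f (s y)) &
      forall u v, E u v -> exists y, f y = u /\ f (s y) = v].
Proof.
elim/Ppointed: X => X infX; first by case: infX; rewrite empty_eq0.
have VX := infinite_card_sum infX.
have infV : infinite_set [set: X + X].
  exact: infinite_set_card_eq (card_esym VX) infX.
have VV := infinite_card_setXTT infV.
have /card_set_bijP[k] := card_eq_trans VV VX.
rewrite setTT_bijective => -[h kK hK].
have [a [b ab]] := infinite_set_distinct infX.
exists (fun y => (h y).1).
  exists (k (inl a, inl a)), (k (inl a, inl b)); split; last by rewrite !kK.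
  by move=> /(can_inj kK) [].
move=> E Exx Esym.
have [s [sK Es Eex]] := edge_switching_involution infV Exx Esym.
exists (k \o s \o h); split=> [y|y|u v /Eex[p [pu pv]]] /=.
- by rewrite kK sK hK.
- by rewrite kK.
- by exists (k p); rewrite !kK.
Qed.

(** * One-sided invertible non-units among the generators *)

Section UnitGenerators.
Context {M : monoidType}.
Implicit Types x y z : M.
Local Open Scope group_scope.

Lemma unitsM x y : units M x -> units M y -> units M (x * y).
Proof.
move=> [x' [xx' x'x]] [y' [yy' y'y]]; exists (y' * x'); split.
  by rewrite mulgA -(mulgA x) yy' mulg1.
by rewrite mulgA -(mulgA y') x'x mulg1.
Qed.

Lemma unitsVr {x y} : units M x -> x * y = 1 -> y * x = 1.
Proof.
move=> [z [xz zx]] xy; suff -> : y = z by [].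
by rewrite -[y]mul1g -zx -mulgA xy mulg1.
Qed.

Lemma unitsVl {x y} : units M y -> x * y = 1 -> y * x = 1.
Proof.
move=> [z [yz zy]] xy; suff -> : x = z by [].
by rewrite -[x]mulg1 -yz mulgA xy mul1g.
Qed.

(* If x y is right invertible then so is x, and y is too as soon as x is a
   unit. *)
Lemma right_invertible_generator {U : set M} {x y} :
  sgenerated (units M `|` U) = [set: M] -> x * y = 1 -> y * x <> 1 ->
  exists2 z, U z & ~ units M z /\ exists t, z * t = 1.
Proof.
move=> genU xy yx; apply: contrapT => noz.
(* [Q] is a subsemigroup containing the units and, by [noz], also [U]; hence it is everything. *)
pose Q : set M := [set z | (exists t, z * t = 1) -> units M z].
suff Qx : Q x by apply: yx; apply: (unitsVr _ xy); apply: Qx; exists y.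
have : sgenerated (units M `|` U) x by rewrite genU.
apply; split=> [z w Qz Qw [t zwt]|z [uz _ //|Uz zt]]; last first.
  by apply: contrapT => nz; apply: noz; exists z.
rewrite -mulgA in zwt.
have Uz : units M z by apply: Qz; exists (w * t).
apply: unitsM => //; apply: Qw; exists (t * z).
by rewrite mulgA; exact: unitsVr zwt.
Qed.

(** Dual argument: in a left invertible product the last factor is left invertible, and so is the
    first once the last is a unit. *)
Lemma left_invertible_generator {U : set M} {x y} :
  sgenerated (units M `|` U) = [set: M] -> x * y = 1 -> y * x <> 1 ->
  exists2 z, U z & ~ units M z /\ exists t, t * z = 1.
Proof.
move=> genU xy yx; apply: contrapT => noz.
pose Q : set M := [set z | (exists t, t * z = 1) -> units M z].
suff Qy : Q y by apply: yx; apply: (unitsVl _ xy); apply: Qy; exists x.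
have : sgenerated (units M `|` U) y by rewrite genU.
apply; split=> [w z Qw Qz [t twz]|z [uz _ //|Uz tz]]; last first.
  by apply: contrapT => nz; apply: noz; exists z.
rewrite mulgA in twz.
have Uz : units M z by apply: Qz; exists (t * w).
apply: unitsM => //; apply: Qw; exists (z * t).
by rewrite -mulgA; exact: unitsVl twz.
Qed.

Lemma two_le_card_generators {U : set M} {x y} :
  sgenerated (units M `|` U) = [set: M] -> x * y = 1 -> y * x <> 1 ->
  `I_2 #<= U.
Proof.
move=> genU xy yx.
have [a Ua [na [a' aa']]] := right_invertible_generator genU xy yx.
have [b Ub [nb [b' bb']]] := left_invertible_generator genU xy yx.
(* An element with both a left and a right inverse is a unit. *)
have ab : a <> b.
  move=> ab; rewrite -ab in bb'; apply: na; exists a'; split=> //.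
  suff <- : b' = a' by [].
  by rewrite -[b']mulg1 -aa' mulgA bb' mul1g.
apply: (rel_card_le (fun i z => z = if i == 0 then a else b)).
  by move=> i _; exists (if i == 0 then a else b) => //; case: ifP.
by move=> [|[|i]] [|[|j]] z //= _ _ -> // e; case: ab.
Qed.

End UnitGenerators.

Lemma set2_card_le {T : Type} (a b : T) : [set a; b] #<= `I_2.
Proof.
apply: (rel_card_le (fun x i => x = if i == 0 then a else b)).
  by move=> x [->|->]; [exists 0|exists 1].
by move=> x y i _ _ -> ->.
Qed.

(** * Partitions as kernels of labellings, and the factorisation *)

Definition ker_partition {X L : Type} (k : X + X -> L) : pmonoid X :=
  PMonoid (equiv_partition (R := fun u v => k u = k v)
    (fun u => erefl) (fun u v => @esym _ _ _) (fun u v w => @etrans _ _ _ _)).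

Lemma same_block_ker {X L : Type} (k : X + X -> L) u v :
  same_block (ker_partition k) u v <-> k u = k v.
Proof.
split=> [[_ [w _ <-] [/= <- <-]]//|kuv].
by exists [set w | k u = k w]; first exists u.
Qed.

(** For involutive [s] the blocks are the pairs of an upper [x] and the lower copy of [s x]. *)
Definition involution_partition {X : Type} (s : X -> X) : pmonoid X :=
  ker_partition (fun u => match u with inl y => y | inr y => s y end).

Lemma involution_partition_unit {X : Type} {s : X -> X} :
  involutive s -> units (pmonoid X) (involution_partition s).
Proof.
move=> sK; rewrite units_blocksE => B; rewrite blocksE => -[u _ <-].
pose x := match u with inl y => y | inr y => s y end.
exists x, (s x); apply/seteqP; split=> -[y|y]; rewrite /= same_block_ker -/x.
- by move=> ->; left.
- by move=> ->; right; rewrite sK.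
- by case=> // -[->].
- by case=> // -[->]; rewrite sK.
Qed.

Section Factorisation.
Context {X : Type} (f : X -> X + X).

(** This is alpha of the overview; [lower_factor] is beta. Labels in [X + X] name the blocks. *)
Definition upper_factor : pmonoid X :=
  ker_partition (fun u => match u with inl x => inl x | inr y => f y end).

Definition lower_factor : pmonoid X :=
  ker_partition (fun u => match u with inl y => f y | inr x => inr x end).

(** A unit on the left only permutes the upper vertices, so the product is again a kernel. *)
Lemma involution_mul_lower {s : X -> X} : involutive s ->
  pmul (involution_partition s) lower_factor =
  ker_partition (fun u => match u with inl y => f (s y) | inr x => inr x end).
Proof.
move=> sK; apply: pmonoid_ext => u v; rewrite same_block_pmul same_block_ker.
set g := involution_partition s.
pose k (p : vertex X) :=
  match p with Upper y => f (s y) | Middle y => f y | Lower x => inr x end.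
have kout w : k (outer_vertex w) =
    match w with inl y => f (s y) | inr x => inr x end by case: w.
have kleft w : k (left_vertex w) =
    f (s match w with inl y => y | inr y => s y end).
  by case: w => y //=; rewrite sK.
rewrite -!kout; split=> [uv|kuv].
  apply: (connected_ind_l (P := fun p => k (outer_vertex u) = k p) uv) => //.
  - by move=> a b /same_block_ker ab ->; rewrite !kleft ab.
  - by move=> [a|a] [b|b] /same_block_ker /= ab ->.
pose r (w : X + X) := match w with inl y => inl (s y) | inr x => inr x end.
have outr w : connected g lower_factor (outer_vertex w) (right_vertex (r w)).
  case: w => y /=; last exact: connected_refl.
  apply: (@connected_left _ _ _ (inl y) (inr (s y))).
  by apply/same_block_ker; rewrite sK.
apply: connected_trans (outr u) _.
apply: connected_trans (connected_sym (outr v)).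
by apply: connected_right; apply/same_block_ker; case: (u) (v) kuv => a [].
Qed.

(** Each middle vertex [y] acts as an edge from [f y] to [f (s y)]. The second hypothesis keeps
    every edge inside a block of [c]; the third supplies an edge between any two vertices of a
    block. *)
Lemma factorisation {c : pmonoid X} {s : X -> X} :
  involutive s ->
  (forall y, same_block c (f y) (f (s y))) ->
  (forall u v, same_block c u v -> exists y, f y = u /\ f (s y) = v) ->
  c = pmul upper_factor (pmul (involution_partition s) lower_factor).
Proof.
move=> sK cs cex; rewrite (involution_mul_lower sK).
set b := ker_partition _.
apply: pmonoid_ext => u v; rewrite same_block_pmul; split=> [cuv|uv].
  (* An upper [w] reaches [y] through an edge [z] from [w] to [f (s y)], a lower [w] through an edge
     [z] from [f y] to [w]. *)
  have to_middle w y : same_block c w (f y) ->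
      connected upper_factor b (outer_vertex w) (Middle y).
    case: w => x wy.
      have [z [zx zy]] : exists z, f z = inl x /\ f (s z) = f (s y).
        by apply: cex; apply: same_block_trans wy (cs y).
      apply: connected_trans
        (@connected_left _ _ _ (inl x) (inr z) _)
        (@connected_right _ _ _ (inl z) (inl y) _); exact/same_block_ker.
    have [z [zy zx]] := cex _ _ (same_block_sym wy).
    apply: connected_trans
      (@connected_right _ _ _ (inr x) (inl z) _)
      (@connected_left _ _ _ (inr z) (inr y) _); exact/same_block_ker.
  have [y [yu yv]] := cex _ _ cuv.
  have uy : same_block c u (f y) by rewrite yu; exact: same_block_refl.
  have vy : same_block c v (f y) by rewrite yu; exact: same_block_sym.
  exact: connected_trans (to_middle u y uy) (connected_sym (to_middle v y vy)).
(* Edges of the upper factor preserve [l]; those of [b] preserve its block in [c], because they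
   preserve the label [m] below. *)
pose l (p : vertex X) :=
  match p with Upper x => inl x | Middle y => f y | Lower x => inr x end.
have lout w : l (outer_vertex w) = w by case: w.
suff : same_block c (l (outer_vertex u)) (l (outer_vertex v)) by rewrite !lout.
apply: (connected_ind_l
  (P := fun p => same_block c (l (outer_vertex u)) (l p)) uv).
- move=> w w' /same_block_ker ww' /same_block_trans; apply.
  suff -> : l (left_vertex w) = l (left_vertex w') by exact: same_block_refl.
  by case: w w' ww' => a [].
- move=> w w' /same_block_ker ww' /same_block_trans; apply.
  pose m (w : X + X) := match w with inl y => f (s y) | inr x => inr x end.
  have cm z : same_block c (l (right_vertex z)) (m z).
    by case: z => z; [exact: cs|exact: same_block_refl].
  apply: same_block_trans (cm w) _.
  by rewrite [m w]ww'; exact/same_block_sym/cm.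
- exact: same_block_refl.
Qed.

(** Lower vertices joined in the right factor stay joined in the product, while the identity
    separates them. *)
Lemma upper_factor_not_left_invertible {c : pmonoid X} {y y' : X} :
  y <> y' -> f y = f y' -> pmul c upper_factor <> pone X.
Proof.
move=> yy' fyy' c1.
have : same_block (pmul c upper_factor) (inr y) (inr y').
  apply/same_block_pmul.
  by apply: (@connected_right _ _ _ (inr y) (inr y')); apply/same_block_ker.
by rewrite c1 => /same_block_pone.
Qed.

End Factorisation.

Theorem theorem12 (X : Type) (infX : infinite_set [set: X]) :
  has_relative_rank (units (pmonoid X)) `I_2.
Proof.
have [f [y [y' [yy' fyy']]] fE] := involution_labelling infX.
pose a := upper_factor f; pose b := lower_factor f.
have abE c : exists2 g, units (pmonoid X) g & c = (a * (g * b))%g.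
  have [s [sK cs cex]] :=
    fE _ (same_block_refl c) (fun u v => @same_block_sym _ c u v).
  exists (involution_partition s); first exact: involution_partition_unit.
  exact: factorisation.
have lower U : sgenerated (units (pmonoid X) `|` U) = [set: pmonoid X] ->
    `I_2 #<= U.
  (* Factoring the identity yields the right inverse [g * b] of [a]. *)
  have [g _ gb] := abE 1%g.
  move=> genU.
  apply: (two_le_card_generators (x := a) (y := (g * b)%g) genU) => //.
  exact: upper_factor_not_left_invertible yy' fyy'.
split; last exact: lower.
have gen : sgenerated (units (pmonoid X) `|` [set a; b]) = [set: pmonoid X].
  apply/seteqP; split=> // c _ S [mulS subS].
  have [g ug ->] := abE c.
  apply: (mulS); [|apply: (mulS)]; apply: subS.
  - by right; left.
  - by left.
  - by right; right.
exists [set a; b] => //.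
(* The lower bound, applied to this generating set, also gives that [a] and [b] differ. *)
apply: Cantor_Bernstein; [exact: set2_card_le|exact: lower].
Qed.
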